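(* Let $n\ge 1$, let $\mathcal{H}$ be the algebra of commutative quaternions, and fix $\kappa\in\{1,2,3\}$. Let $p_0,p_1,\dots,p_{n-1},\psi_1,\dots,\psi_{n-1}\in\mathcal{H}$ and let $T=(t_{ij})_{i,j=0}^{n-1}$ be the Toeplitz matrix over $\mathcal{H}$ with $t_{ij}=p_{i-j}$ for $i\ge j$ and $t_{ij}=\psi_{j-i}^{(\kappa)}$ for $i<j$, that is, $$T=\begin{pmatrix} p_0 & \psi_1^{(\kappa)} & \cdots & \psi_{n-1}^{(\kappa)}\\ p_1 & p_0 & \cdots & \psi_{n-2}^{(\kappa)}\\ \vdots & \vdots & \ddots & \vdots\\ p_{n-1} & p_{n-2} & \cdots & p_0\end{pmatrix}.$$ Then $T^{\dagger\kappa}T-TT^{\dagger\kappa}=0$ if and only if for all $s,k$ with $1\le s,k\le n-1$, $$p_s\,p_k^{(\kappa)}+p_{n-s}^{(\kappa)}\,p_{n-k}=\psi_s\,\psi_k^{(\kappa)}+\psi_{n-s}^{(\kappa)}\,\psi_{n-k}.$$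
   Context: The commutative quaternions are $\mathcal{H}=\{a_0+a_1\mathbf{i}+a_2\mathbf{j}+a_3\mathbf{k}: a_0,a_1,a_2,a_3\in\mathbb{R}\}$, the $4$-dimensional commutative associative real algebra with unit $\mathbf{1}$ and multiplication rules $\mathbf{i}^2=\mathbf{k}^2=-1$, $\mathbf{j}^2=1$, $\mathbf{i}\mathbf{j}=\mathbf{j}\mathbf{i}=\mathbf{k}$, $\mathbf{j}\mathbf{k}=\mathbf{k}\mathbf{j}=\mathbf{i}$, $\mathbf{k}\mathbf{i}=\mathbf{i}\mathbf{k}=-\mathbf{j}$. For $a=a_0+a_1\mathbf{i}+a_2\mathbf{j}+a_3\mathbf{k}\in\mathcal{H}$ the three principal conjugates are $a^{(1)}=a_0-a_1\mathbf{i}+a_2\mathbf{j}-a_3\mathbf{k}$, $a^{(2)}=a_0+a_1\mathbf{i}-a_2\mathbf{j}-a_3\mathbf{k}$, $a^{(3)}=a_0-a_1\mathbf{i}-a_2\mathbf{j}+a_3\mathbf{k}$. For an $n\times n$ matrix $T=(t_{ij})$ over $\mathcal{H}$, $T^{(\kappa)}=(t_{ij}^{(\kappa)})$ and the $\kappa$-th adjoint is $T^{\dagger\kappa}=(T^{(\kappa)})^t$, the transpose of $T^{(\kappa)}$. $T$ is called normal with respect to the $\kappa$-th conjugate if $TT^{\dagger\kappa}=T^{\dagger\kappa}T$. *)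

(* Defs.v *)
From HB Require Import structures.
From mathcomp Require Import all_boot all_order all_algebra.
From mathcomp Require Import reals.
From mathcomp Require Import ring.

Set Implicit Arguments.
Unset Strict Implicit.
Unset Printing Implicit Defensive.

Import GRing.Theory.
Local Open Scope ring_scope.

(* [CQuat a0 a1 a2 a3] stands for a0 + a1 i + a2 j + a3 k. The construction
   works over any nontrivial commutative ring; the commutative quaternions
   proper are [cquat R] for R the reals. *)
Record cquat (R : Type) := CQuat { cq0 : R; cq1 : R; cq2 : R; cq3 : R }.

Section CommutativeQuaternions.
Variable R : comNzRingType.
Implicit Types a b c : cquat R.

Definition cquat_tuple a := (cq0 a, cq1 a, cq2 a, cq3 a).
Definition tuple_cquat (u : R * R * R * R) :=
  let: (a0, a1, a2, a3) := u in CQuat a0 a1 a2 a3.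

Lemma cquat_tupleK : cancel cquat_tuple tuple_cquat.
Proof. by case. Qed.

HB.instance Definition _ := Choice.copy (cquat R) (can_type cquat_tupleK).

Definition cq_zero : cquat R := CQuat 0 0 0 0.
Definition cq_opp a := CQuat (- cq0 a) (- cq1 a) (- cq2 a) (- cq3 a).
Definition cq_add a b :=
  CQuat (cq0 a + cq0 b) (cq1 a + cq1 b) (cq2 a + cq2 b) (cq3 a + cq3 b).

Lemma cq_addA : associative cq_add.
Proof. by move=> [????] [????] [????]; rewrite /cq_add /= !addrA. Qed.
Lemma cq_addC : commutative cq_add.
Proof. by move=> [????] [????]; congr CQuat; rewrite addrC. Qed.
Lemma cq_add0 : left_id cq_zero cq_add.
Proof. by move=> [????]; rewrite /cq_add /= !add0r. Qed.
Lemma cq_addN : left_inverse cq_zero cq_opp cq_add.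
Proof. by move=> [????]; rewrite /cq_add /= !addNr. Qed.

HB.instance Definition _ :=
  GRing.isZmodule.Build (cquat R) cq_addA cq_addC cq_add0 cq_addN.

Definition cq_one : cquat R := CQuat 1 0 0 0.

(* Bilinear extension of the table i^2 = k^2 = -1, j^2 = 1, ij = k, jk = i,
   ki = -j; see [cq_mul_table]. *)
Definition cq_mul a b :=
  CQuat
    (cq0 a * cq0 b - cq1 a * cq1 b + cq2 a * cq2 b - cq3 a * cq3 b)
    (cq0 a * cq1 b + cq1 a * cq0 b + cq2 a * cq3 b + cq3 a * cq2 b)
    (cq0 a * cq2 b + cq2 a * cq0 b - cq1 a * cq3 b - cq3 a * cq1 b)
    (cq0 a * cq3 b + cq3 a * cq0 b + cq1 a * cq2 b + cq2 a * cq1 b).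

Lemma cq_mulA : associative cq_mul.
Proof. by move=> [????] [????] [????]; congr CQuat => /=; ring. Qed.
Lemma cq_mulC : commutative cq_mul.
Proof. by move=> [????] [????]; congr CQuat => /=; ring. Qed.
Lemma cq_mul1 : left_id cq_one cq_mul.
Proof. by move=> [????]; rewrite /cq_mul /=; congr CQuat; ring. Qed.
Lemma cq_mulDl : left_distributive cq_mul cq_add.
Proof. by move=> [????] [????] [????]; congr CQuat => /=; ring. Qed.
Lemma cq_one_neq0 : cq_one != 0.
Proof. by apply/eqP => -[] /eqP; rewrite oner_eq0. Qed.

HB.instance Definition _ := GRing.Zmodule_isComNzRing.Build (cquat R)
  cq_mulA cq_mulC cq_mul1 cq_mulDl cq_one_neq0.

Definition cq_scale (x : R) a :=
  CQuat (x * cq0 a) (x * cq1 a) (x * cq2 a) (x * cq3 a).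

Lemma cq_scaleA x y a : cq_scale x (cq_scale y a) = cq_scale (x * y) a.
Proof. by congr CQuat; rewrite /= mulrA. Qed.
Lemma cq_scale1 : left_id 1 cq_scale.
Proof. by move=> [????]; rewrite /cq_scale /= !mul1r. Qed.
Lemma cq_scaleDr : right_distributive cq_scale +%R.
Proof. by move=> x a b; congr CQuat; rewrite /= mulrDr. Qed.
Lemma cq_scaleDl a : {morph cq_scale^~ a : x y / x + y}.
Proof. by move=> x y; congr CQuat; rewrite /= mulrDl. Qed.

HB.instance Definition _ := GRing.Zmodule_isLmodule.Build R (cquat R)
  cq_scaleA cq_scale1 cq_scaleDr cq_scaleDl.

Lemma cq_scaleAl (x : R) a b : x *: (a * b) = (x *: a) * b.
Proof. by case: a b => [????] [????]; congr CQuat => /=; ring. Qed.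

HB.instance Definition _ :=
  GRing.Lmodule_isLalgebra.Build R (cquat R) cq_scaleAl.

Definition cqi : cquat R := CQuat 0 1 0 0.
Definition cqj : cquat R := CQuat 0 0 1 0.
Definition cqk : cquat R := CQuat 0 0 0 1.

Lemma cquatE (a0 a1 a2 a3 : R) :
  CQuat a0 a1 a2 a3 = a0 *: 1 + a1 *: cqi + a2 *: cqj + a3 *: cqk.
Proof. by congr CQuat => /=; ring. Qed.

Lemma cq_mul_table :
  [/\ cqi * cqi = -1, cqk * cqk = -1 & cqj * cqj = 1] /\
  [/\ cqi * cqj = cqk, cqj * cqk = cqi & cqk * cqi = - cqj].
Proof. by do 2!split; congr CQuat => /=; ring. Qed.

End CommutativeQuaternions.

Variant conj_index := Conj1 | Conj2 | Conj3.

Definition cqconj (R : comNzRingType) (kappa : conj_index) (a : cquat R) :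
    cquat R :=
  let: CQuat a0 a1 a2 a3 := a in
  match kappa with
  | Conj1 => CQuat a0 (- a1) a2 (- a3)
  | Conj2 => CQuat a0 a1 (- a2) (- a3)
  | Conj3 => CQuat a0 (- a1) (- a2) a3
  end.

Definition cqadjoint (R : comNzRingType) (kappa : conj_index) (m n : nat)
    (T : 'M[cquat R]_(m, n)) : 'M[cquat R]_(n, m) :=
  (map_mx (cqconj kappa) T)^T.

(* Only p 0, ..., p (n - 1) and psi 1, ..., psi (n - 1) are used. *)
Definition cqtoeplitz (R : comNzRingType) (kappa : conj_index) (n : nat)
    (p psi : nat -> cquat R) : 'M[cquat R]_n :=
  \matrix_(i < n, j < n)
    if (j <= i)%N then p (i - j)%N else cqconj kappa (psi (j - i)%N).

(* Main.v *)
Require Import Defs.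
From mathcomp Require Import all_boot all_order all_algebra.
From mathcomp Require Import reals.
From mathcomp Require Import ring zify.

Import GRing.Theory.
Local Open Scope ring_scope.

(** Both [T] and its adjoint [U] are Toeplitz, so the difference between the
    [(s, k)] and [(s - 1, k - 1)] entries of the commutator [D = U T - T U]
    telescopes to the difference of the two sides of the condition at [(s, k)].
    Hence the condition says exactly that [D] is a Toeplitz matrix.  Reversing
    the order of summation shows that [D] is antisymmetric under reflection in
    the antidiagonal, whereas every Toeplitz matrix is symmetric under it; so
    [2 D = 0] as soon as [D] is Toeplitz. *)

(** Term [m + 1] of the first sum is term [m] of the second, so only the first term of the one and
    the last term of the other survive. *)
Lemma telescope_shift (V : zmodType) (n : nat) (g : int -> int -> V)
    (i j : int) :
  \sum_(m < n.+1) g (i + 1 - m%:Z) (m%:Z - (j + 1))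
    - \sum_(m < n.+1) g (i - m%:Z) (m%:Z - j) =
  g (i + 1) (- (j + 1)) - g (i - n%:Z) (n%:Z - j).
Proof.
rewrite big_ord_recl [X in _ - X]big_ord_recr /= subr0 sub0r.
under eq_bigr => m _.
  rewrite (_ : i + 1 - _ = i - m%:Z); last by rewrite /bump /=; lia.
  rewrite (_ : _ - (j + 1) = m%:Z - j); last by rewrite /bump /=; lia.
  over.
by rewrite addrKA.
Qed.

(** The substitution of [n - m] for [m] swaps the two arguments of [g]. The left side belongs to the
    position [(n - j, n - i)], the mirror image of [(i, j)] in the antidiagonal. *)
Lemma alternating_sum_reflect (V : zmodType) (n : nat) (g : int -> int -> V)
    (i j : int) :
  (forall x y, g y x = - g x y) ->
  \sum_(m < n.+1) g (n%:Z - j - m%:Z) (m%:Z - (n%:Z - i)) =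
  - \sum_(m < n.+1) g (i - m%:Z) (m%:Z - j).
Proof.
move=> gN; rewrite (reindex_inj rev_ord_inj) -sumrN /=.
apply: eq_bigr => m _; rewrite -gN.
by congr g; have := ltn_ord m; lia.
Qed.

Definition toeplitz_mx (S : Type) (n : nat) (t : int -> S) : 'M[S]_n :=
  \matrix_(i < n, j < n) t (i%:Z - j%:Z).

Lemma toeplitz_mx_commute (S : comNzRingType) (n : nat) (t u : int -> S) :
  (forall x : S, x *+ 2 = 0 -> x = 0) ->
  toeplitz_mx S n u *m toeplitz_mx S n t
    - toeplitz_mx S n t *m toeplitz_mx S n u = 0 <->
  (forall s k : nat, (1 <= s <= n - 1)%N -> (1 <= k <= n - 1)%N ->
     u s%:Z * t (- k%:Z) - t s%:Z * u (- k%:Z) =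
     u (s%:Z - n%:Z) * t (n%:Z - k%:Z) - t (s%:Z - n%:Z) * u (n%:Z - k%:Z)).
Proof.
move=> reg2; case: n => [|n].
  split=> [_ s k|_]; first by lia.
  by apply/matrixP => -[].
pose g x y := u x * t y - t x * u y.
(* Integer arguments let [D] be shifted and reflected without ordinals. *)
pose D i j := \sum_(m < n.+1) g (i - m%:Z) (m%:Z - j).
have gN x y : g y x = - g x y by rewrite /g; ring.
set C := _ - _; have CE i j : C i j = D i%:Z j%:Z.
  rewrite !mxE -sumrB; apply: eq_bigr => m _.
  by rewrite !mxE.
(* The right side is the defect of the condition at [s = i + 1], [k = j + 1]. *)
have DS (i j : nat) : D i.+1%:Z j.+1%:Z - D i%:Z j%:Z
    = g i.+1%:Z (- j.+1%:Z)
      - g (i.+1%:Z - n.+1%:Z) (n.+1%:Z - j.+1%:Z).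
  rewrite /D !(intS i, intS j) ![1 + _]addrC telescope_shift.
  by congr (_ - g _ _); lia.
split=> [C0 [//|s] [//|k] sn kn|cond].
  have D0 (i j : nat) : (i < n.+1)%N -> (j < n.+1)%N -> D i%:Z j%:Z = 0.
    by move=> ilt jlt; rewrite -(CE (Ordinal ilt) (Ordinal jlt)) C0 mxE.
  apply/eqP; rewrite -subr_eq0; apply/eqP.
  by have := DS s k; rewrite !D0 ?subr0 /g; [move=> <- | lia..].
have Dtoep (d i j : nat) : (i + d <= n)%N -> (j + d <= n)%N ->
    D (i + d)%N%:Z (j + d)%N%:Z = D i%:Z j%:Z.
  elim: d => [|d IHd] id jd; first by rewrite !addn0.
  rewrite -IHd; [|lia..]; apply/eqP; rewrite -subr_eq0 !addnS DS subr_eq0.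
  by apply/eqP/cond; lia.
apply/matrixP => i j; rewrite CE mxE; apply: reg2.
have ilt := ltn_ord i; have jlt := ltn_ord j.
(* Both positions lie on one diagonal, [n - (i + j)] steps apart; the sign of this number decides
   from which end [Dtoep] is applied. *)
have Drefl : D i%:Z j%:Z = D (n%:Z - j%:Z) (n%:Z - i%:Z).
  have [ijn|nij] := leqP (i + j) n.
    rewrite -(Dtoep (n - (i + j))%N); [|lia..].
    by congr D; lia.
  have -> : n%:Z - j%:Z = (n - j)%N%:Z by lia.
  have -> : n%:Z - i%:Z = (n - i)%N%:Z by lia.
  rewrite -(Dtoep (i + j - n)%N (n - j)%N); [|lia..].
  by congr D; lia.
rewrite mulr2n {1}Drefl /D alternating_sum_reflect //.
by rewrite addNr.
Qed.

Lemma cqconjK (R : comNzRingType) (kappa : conj_index) :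
  involutive (@cqconj R kappa).
Proof. by case: kappa => -[a0 a1 a2 a3]; rewrite /cqconj !opprK. Qed.

Lemma cquat_mulr2n_eq0 (R : numDomainType) (a : cquat R) : a *+ 2 = 0 -> a = 0.
Proof.
case: a => a0 a1 a2 a3; rewrite mulr2n => -[].
by do 4![rewrite -mulr2n => /eqP; rewrite Num.Theory.mulrn_eq0 /= => /eqP ->].
Qed.

(** [Negz m] denotes [- (m + 1)], whence the index [m.+1]. *)
Definition cqtoeplitz_symbol (R : comNzRingType) (kappa : conj_index)
    (p psi : nat -> cquat R) (d : int) : cquat R :=
  match d with
  | Posz m => p m
  | Negz m => cqconj kappa (psi m.+1)
  end.

Lemma cqtoeplitzE (R : comNzRingType) (kappa : conj_index) (n : nat)
    (p psi : nat -> cquat R) :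
  cqtoeplitz kappa n p psi =
  toeplitz_mx (cquat R) n (cqtoeplitz_symbol R kappa p psi).
Proof.
apply/matrixP => i j; rewrite !mxE; case: leqP => [ji|ij].
  by have -> : i%:Z - j%:Z = (i - j)%N%:Z by lia.
have -> : i%:Z - j%:Z = Negz (j - i).-1 by lia.
by rewrite /= prednK // subn_gt0.
Qed.

Lemma cqadjoint_toeplitz_mx (R : comNzRingType) (kappa : conj_index) (n : nat)
    (t : int -> cquat R) :
  cqadjoint kappa (toeplitz_mx (cquat R) n t) =
  toeplitz_mx (cquat R) n (fun d => cqconj kappa (t (- d))).
Proof. by apply/matrixP => i j; rewrite !mxE opprB. Qed.

Theorem theorem5p2 (R : realType) (n : nat) (hn : (1 <= n)%N)
    (kappa : conj_index) (p psi : nat -> cquat R) :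
  let T : 'M[cquat R]_n := cqtoeplitz kappa n p psi in
  cqadjoint kappa T *m T - T *m cqadjoint kappa T = 0 <->
  (forall s k : nat, (1 <= s <= n - 1)%N -> (1 <= k <= n - 1)%N ->
     p s * cqconj kappa (p k) + cqconj kappa (p (n - s)%N) * p (n - k)%N =
     psi s * cqconj kappa (psi k)
       + cqconj kappa (psi (n - s)%N) * psi (n - k)%N).
Proof.
move=> T; rewrite /T cqtoeplitzE cqadjoint_toeplitz_mx.
apply: iff_trans (toeplitz_mx_commute _ _ _ _ (cquat_mulr2n_eq0 R)) _.
set t := cqtoeplitz_symbol R kappa p psi.
(* Positivity matters: at [m = 0] the value is [p 0]. The bounds on [s] and [k] also make [n - s]
   and [n - k] positive. *)
have tN (m : nat) : (0 < m)%N -> t (- m%:Z) = cqconj kappa (psi m).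
  by case: m.
have symbolE (s k : nat) : (1 <= s <= n - 1)%N -> (1 <= k <= n - 1)%N ->
    [/\ t (- s%:Z) = cqconj kappa (psi s),
        t (- k%:Z) = cqconj kappa (psi k),
        t (s%:Z - n%:Z) = cqconj kappa (psi (n - s)%N)
      & t (- (n%:Z - k%:Z)) = cqconj kappa (psi (n - k)%N)] /\
    t (- (s%:Z - n%:Z)) = p (n - s)%N /\ t (n%:Z - k%:Z) = p (n - k)%N.
  move=> sn kn.
  have -> : s%:Z - n%:Z = - (n - s)%N%:Z by lia.
  have -> : n%:Z - k%:Z = (n - k)%N%:Z by lia.
  by rewrite opprK; split; [split; apply: tN; lia | split].
(* Since conjugation is an involution, the general condition becomes the stated one with the [p s]
   and [psi (n - s)] products moved across the equality. *)
split=> cond s k sn kn; have := cond s k sn kn;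
  have [[tNs tNk tsn tnk] [tNsn tnk']] := symbolE s k sn kn;
  rewrite !opprK tNs tNk tsn tnk tNsn tnk' !cqconjK /= => E.
  have -> : p s * cqconj kappa (p k) = psi s * cqconj kappa (psi k)
      - (psi s * cqconj kappa (psi k) - p s * cqconj kappa (p k)) by ring.
  by rewrite E; ring.
have -> : psi s * cqconj kappa (psi k) = p s * cqconj kappa (p k)
    + cqconj kappa (p (n - s)%N) * p (n - k)%N
    - cqconj kappa (psi (n - s)%N) * psi (n - k)%N by rewrite E; ring.
by ring.
Qed.
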